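(* Consider the discrete-time linear system $x(k+1)=Ax(k)+Bu(k)$ with the polytopic constraint sets $\mathcal{X}$, $\mathcal{U}$, the gain $K$, the terminal set $\mathcal{X}_f$, the matrices $M$, $P$ and the barrier functions $B_x$, $B_u$, $B_f$ described in the context, and suppose conditions (A1)–(A5) of the context hold. Let the feasible set $\mathcal{X}_N$ (defined in the context) have nonempty interior. For $x\in\mathcal{X}_N^\circ$ let $\tilde{\mathbf u}^*(x)=(\tilde u_0^*(x),\dots,\tilde u_{N-1}^*(x))$ be the minimizer of the barrier function based problem $$\tilde J_N^*(x)=\min_{\mathbf u}\ \sum_{k=0}^{N-1}\big[\ell(x_k,u_k)+\varepsilon B_u(u_k)+\varepsilon B_x(x_k)\big]+x_N^\top P x_N+\varepsilon B_f(x_N)$$ subject to $x_0=x$, $x_{k+1}=Ax_k+Bu_k$ (each barrier term being $+\infty$ outside the interior of its domain). Then the feedback $u(k)=\tilde u_0^*(x(k))$ asymptotically stabilizes the origin of the system under strict satisfaction of all input and state constraints for every initial condition $x(0)\in\mathcal{X}_N^\circ$; i.e., for every $x(0)\in\mathcal{X}_N^\circ$ the closed-loop states and inputs remain strictly inside $\mathcal{X}$ and $\mathcal{U}$ for all $k\ge0$, and the origin is asymptotically stable for the closed loop with $\mathcal{X}_N^\circ$ contained in its region of attraction.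
   Context: System: $x(k+1)=Ax(k)+Bu(k)$, $A\in\mathbb{R}^{n\times n}$, $B\in\mathbb{R}^{n\times m}$, $(A,B)$ stabilizable. Constraint sets are (compact) polytopes $\mathcal{X}=\{x: C_xx\le d_x\}$, $\mathcal{U}=\{u: C_uu\le d_u\}$ with $C_x\in\mathbb{R}^{q_x\times n}$, $C_u\in\mathbb{R}^{q_u\times m}$, and $d_x\in\mathbb{R}^{q_x}$, $d_u\in\mathbb{R}^{q_u}$ having strictly positive entries; $C^i$ denotes the $i$-th row and $d^i$ the $i$-th entry; $S^\circ$, $\partial S$ denote interior and boundary. Stage cost $\ell(x,u)=x^\top Qx+u^\top Ru$ with $Q$ symmetric positive semidefinite, $R$ symmetric positive definite; horizon $N\in\mathbb{N}_{\ge1}$; barrier weight $\varepsilon>0$; predicted states $x_0=x$, $x_{k+1}=Ax_k+Bu_k$. Recentered logarithmic barriers: for a polytope $\{z: Cz\le d\}$ with $d>0$ entrywise, let $\bar B_i(z)=-\ln(-C^iz+d^i)$ and $\bar B=\sum_i\bar B_i$. The gradient recentered barrier is $\bar B(z)-\bar B(0)-\nabla\bar B(0)^\top z$; the weight recentered barrier is $\sum_i(1+w^i)(\bar B_i(z)-\bar B_i(0))$ with a vector $w\ge0$ chosen such that $\sum_i(1+w^i)\nabla\bar B_i(0)=0$. Conditions: $K\in\mathbb{R}^{m\times n}$ is a stabilizing gain ($A_K:=A+BK$ Schur); $\mathcal{X}_K:=\{x\in\mathcal{X}: Kx\in\mathcal{U}\}$ and $B_K(x):=B_x(x)+B_u(Kx)$.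 (A1) $B_x$ and $B_u$ are recentered (gradient or weight recentered) logarithmic barrier functions for $\mathcal{X}$ and $\mathcal{U}$. (A2) There is a symmetric positive semidefinite $M$ with $B_K(x)\le x^\top Mx$ for all $x\in\mathcal{N}$, where $\mathcal{N}\subset\mathcal{X}_K$ is convex and compact with $0\in\mathcal{N}^\circ$. (A3) $P$ is symmetric positive definite and solves $P=A_K^\top PA_K+K^\top RK+Q+\varepsilon M$. (A4) The terminal set $\mathcal{X}_f$ is convex and compact with $0\in\mathcal{X}_f$, $\mathcal{X}_f\subset\mathcal{N}\subset\mathcal{X}_K$, and $A_Kx\in\mathcal{X}_f$ for all $x\in\mathcal{X}_f$. (A5) $B_f:\mathcal{X}_f^\circ\to\mathbb{R}_{\ge0}$ is a recentered barrier function for $\mathcal{X}_f$ (convex, continuously differentiable, $B_f(0)=0$, $B_f(x)\to\infty$ as $x\to\partial\mathcal{X}_f$) and $B_f(A_Kx)-B_f(x)\le0$ for all $x\in\mathcal{X}_f^\circ$. Feasible set: $\mathcal{X}_N=\{x\in\mathcal{X}:\exists\,\mathbf u=(u_0,\dots,u_{N-1})$ with $u_k\in\mathcal{U}$, $x_k\in\mathcal{X}$ for $k=0,\dots,N-1$ and $x_N\in\mathcal{X}_f\}$, where $x_k$ are the predicted states from $x_0=x$. *)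

(* Defs.v *)
From HB Require Import structures.
From mathcomp Require Import all_boot all_order all_algebra.
From mathcomp Require Import all_classical all_reals all_analysis.
From mathcomp Require Import complex.
Set Implicit Arguments. Unset Strict Implicit. Unset Printing Implicit Defensive.
Import Order.TTheory GRing.Theory Num.Theory.
Import numFieldNormedType.Exports.
Local Open Scope classical_set_scope.
Local Open Scope ring_scope.

Section Defs.
Variable R : realType.

Definition qf (n : nat) (P : 'M[R]_n) (x : 'cV[R]_n) : R := (x^T *m P *m x) 0 0.

Definition symmetric (n : nat) (P : 'M[R]_n) : Prop := P^T = P.
Definition psd (n : nat) (P : 'M[R]_n) : Prop :=
  symmetric P /\ forall x : 'cV[R]_n, 0 <= qf P x.
Definition pd (n : nat) (P : 'M[R]_n) : Prop :=
  symmetric P /\ forall x : 'cV[R]_n, x != 0 -> 0 < qf P x.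

Definition schur (n : nat) (A : 'M[R]_n) : Prop :=
  forall z : R[i], root (char_poly (map_mx (real_complex R) A)) z -> `|z| < 1.

(* the polytope {z : C z <= d} and its interior {z : C z < d} (domain of the
   logarithmic barrier) *)
Definition polytope (q n : nat) (C : 'M[R]_(q, n)) (d : 'cV[R]_q) : set 'cV[R]_n :=
  [set z | forall i : 'I_q, (C *m z) i 0 <= d i 0].
Definition polytope_strict (q n : nat) (C : 'M[R]_(q, n)) (d : 'cV[R]_q)
  : set 'cV[R]_n := [set z | forall i : 'I_q, (C *m z) i 0 < d i 0].

Definition barB_i (q n : nat) (C : 'M[R]_(q, n)) (d : 'cV[R]_q) (i : 'I_q)
  (z : 'cV[R]_n) : R := - ln (d i 0 - (C *m z) i 0).
Definition barB (q n : nat) (C : 'M[R]_(q, n)) (d : 'cV[R]_q) (z : 'cV[R]_n) : R :=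
  \sum_(i < q) barB_i C d i z.

Definition grad_barB_i0 (q n : nat) (C : 'M[R]_(q, n)) (d : 'cV[R]_q) (i : 'I_q)
  : 'cV[R]_n := (d i 0)^-1 *: (row i C)^T.
Definition grad_barB0 (q n : nat) (C : 'M[R]_(q, n)) (d : 'cV[R]_q) : 'cV[R]_n :=
  \sum_(i < q) grad_barB_i0 C d i.

Definition grad_rec_barrier (q n : nat) (C : 'M[R]_(q, n)) (d : 'cV[R]_q)
  (z : 'cV[R]_n) : R :=
  barB C d z - barB C d 0 - ((grad_barB0 C d)^T *m z) 0 0.

Definition weight_rec_barrier (q n : nat) (C : 'M[R]_(q, n)) (d : 'cV[R]_q)
  (w : 'cV[R]_q) (z : 'cV[R]_n) : R :=
  \sum_(i < q) (1 + w i 0) * (barB_i C d i z - barB_i C d i 0).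

Definition admissible_weight (q n : nat) (C : 'M[R]_(q, n)) (d : 'cV[R]_q)
  (w : 'cV[R]_q) : Prop :=
  (forall i, 0 <= w i 0) /\ \sum_(i < q) (1 + w i 0) *: grad_barB_i0 C d i = 0.

Definition recentered_log_barrier (q n : nat) (C : 'M[R]_(q, n)) (d : 'cV[R]_q)
  (Bz : 'cV[R]_n -> R) : Prop :=
  (forall z, polytope_strict C d z -> Bz z = grad_rec_barrier C d z) \/
  (exists w, admissible_weight C d w /\
     forall z, polytope_strict C d z -> Bz z = weight_rec_barrier C d w z).

Definition ext (T : Type) (S : set T) (f : T -> R) (z : T) : \bar R :=
  if `[< S z >] then (f z)%:E else +oo%E.

(* continuously differentiable on the open set S: differentiable at every
   point of S, and every directional derivative x |-> 'd f x v is continuous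
   on S (equivalent to continuity of x |-> 'd f x in finite dimension) *)
Definition C1_on (n : nat) (S : set 'cV[R]_n) (f : 'cV[R]_n -> R) : Prop :=
  (forall x, S x -> differentiable f x) /\
  (forall v : 'cV[R]_n, {within S, continuous (fun x => 'd f x v)}).

Definition boundary (n : nat) (S : set 'cV[R]_n) : set 'cV[R]_n :=
  closure S `\` interior S.

Definition recentered_barrier (n : nat) (Xf : set 'cV[R]_n) (Bf : 'cV[R]_n -> R)
  : Prop :=
  [/\ interior Xf 0 /\ Bf 0 = 0,
      (forall x, interior Xf x -> 0 <= Bf x),
      convex_function (interior Xf) Bf,
      C1_on (interior Xf) Bf &
      forall xb, boundary Xf xb ->
        forall M : R, exists2 e : R, 0 < e &
          forall y, interior Xf y -> ball xb e y -> M < Bf y].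

Fixpoint pred_state (n m : nat) (A : 'M[R]_n) (B : 'M[R]_(n, m)) (x : 'cV[R]_n)
  (u : nat -> 'cV[R]_m) (k : nat) : 'cV[R]_n :=
  match k with
  | 0 => x
  | k'.+1 => A *m pred_state A B x u k' + B *m u k'
  end.

Definition feasible_set (n m N : nat) (A : 'M[R]_n) (B : 'M[R]_(n, m))
  (X : set 'cV[R]_n) (U : set 'cV[R]_m) (Xf : set 'cV[R]_n) : set 'cV[R]_n :=
  [set x | X x /\ exists u : nat -> 'cV[R]_m,
     (forall k, (k < N)%N -> U (u k) /\ X (pred_state A B x u k)) /\
     Xf (pred_state A B x u N)].

Definition barrier_cost (n m qx qu N : nat) (A : 'M[R]_n) (B : 'M[R]_(n, m))
  (Cx : 'M[R]_(qx, n)) (dx : 'cV[R]_qx) (Cu : 'M[R]_(qu, m)) (du : 'cV[R]_qu)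
  (Q : 'M[R]_n) (Rw : 'M[R]_m) (P : 'M[R]_n) (eps : R)
  (Bx : 'cV[R]_n -> R) (Bu : 'cV[R]_m -> R) (Xf : set 'cV[R]_n) (Bf : 'cV[R]_n -> R)
  (x : 'cV[R]_n) (u : nat -> 'cV[R]_m) : \bar R :=
  let xs := pred_state A B x u in
  ((\sum_(k < N)
      ((qf Q (xs k) + qf Rw (u k))%:E
       + eps%:E * ext (polytope_strict Cu du) Bu (u k)
       + eps%:E * ext (polytope_strict Cx dx) Bx (xs k)))
   + (qf P (xs N))%:E + eps%:E * ext (interior Xf) Bf (xs N))%E.

Fixpoint cl_state (n m : nat) (A : 'M[R]_n) (B : 'M[R]_(n, m))
  (ustar : 'cV[R]_n -> nat -> 'cV[R]_m) (x0 : 'cV[R]_n) (k : nat) : 'cV[R]_n :=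
  match k with
  | 0 => x0
  | k'.+1 => let s := cl_state A B ustar x0 k' in A *m s + B *m ustar s 0%N
  end.

End Defs.

(* Main.v *)
(** Call [f] a barrier of [S] when [exp (- f)], extended by [0] outside [S], is
continuous.  Barriers are stable under sums, positive multiples and continuous
substitutions, so the cost of an input sequence is a barrier of the strictly feasible
sequences, and it attains its minimum by compactness.  With [s i = 1 - C i z / d i],
both kinds of recentering turn the logarithmic barrier into
[sum_i c i * (s i - 1 - ln (s i))] with [c i >= 1], which is nonnegative and, when
the polytope is bounded, small only near the origin.  The interior of the feasible set
consists of the states that admit strictly feasible inputs: dilate the state slightly,
take feasible inputs there and scale back.  The optimal cost is a Lyapunov function:
appending the terminal controller to a strictly feasible input sequence does not
increase the cost, by (A2), (A3) and (A5), so along the closed loop the optimal cost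
drops by at least [eps * Bx x], and it is at most [x^T P x + eps * Bf x] near the
origin. *)

Require Import Defs.
From HB Require Import structures.
From mathcomp Require Import all_boot all_order all_algebra.
From mathcomp Require Import all_classical all_reals all_analysis.
From mathcomp Require Import complex.
From mathcomp Require Import ring lra.
Import Order.TTheory GRing.Theory Num.Theory.
Import numFieldNormedType.Exports.
Local Open Scope classical_set_scope.
Local Open Scope ring_scope.

Set Implicit Arguments.
Unset Strict Implicit.
Unset Printing Implicit Defensive.

Lemma near_eq_continuous_at (T U : topologicalType) (f g : T -> U) (x : T) :
  (\forall y \near x, g y = f y) -> {for x, continuous g} -> {for x, continuous f}.
Proof.
move=> gf cg; rewrite /prop_for /continuous_at -(nbhs_singleton gf).
exact: cvg_trans (near_eq_cvg gf) cg.
Qed.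

Lemma open_setX (T U : topologicalType) (V : set T) (W : set U) :
  open V -> open W -> open (V `*` W).
Proof.
rewrite !openE => openV openW [x y] [Vx Wy].
by exists (V, W) => //; split; [exact: openV|exact: openW].
Qed.

Lemma continuous_mx (T U : topologicalType) (m n : nat) (f : T -> 'M[U]_(m, n)) :
  (forall i j, continuous (fun x => f x i j)) -> continuous f.
Proof.
move=> cf x V [P fxP PV].
have : \forall y \near x, forall i j, P i j (f y i j).
  by apply: filter_forall => i; apply: filter_forall => j; exact: cf (fxP i j).
by apply: filterS => y Py; exact: PV.
Qed.

Lemma mulmx_coord_continuous (R : numFieldType) (m n p : nat) (A : 'M[R]_(m, n)) i j :
  continuous (fun X : 'M[R]_(n, p) => (A *m X) i j).
Proof.
have -> : (fun X : 'M[R]_(n, p) => (A *m X) i j) = fun X => \sum_k A i k * X k j.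
  by apply/funext => X; rewrite mxE.
apply: continuous_big => [|k _ X]; first exact: add_continuous.
by apply: continuousM; [exact: cst_continuous|exact: coord_continuous].
Qed.

Lemma mulmx_continuous (R : numFieldType) (m n p : nat) (A : 'M[R]_(m, n)) :
  continuous (fun X : 'M[R]_(n, p) => A *m X).
Proof. by apply: continuous_mx => i j; exact: mulmx_coord_continuous. Qed.

Lemma qf_continuous (R : realType) (n : nat) (P : 'M[R]_n) : continuous (qf P).
Proof.
have qfE : qf P = fun x => \sum_k x k 0 * (P *m x) k 0.
  by apply/funext => x; rewrite /qf -mulmxA mxE; apply: eq_bigr => k _; rewrite mxE.
rewrite qfE; apply: continuous_big => [|k _ x]; first exact: add_continuous.
apply: (continuousM (@coord_continuous _ _ _ k 0 x)).
exact: mulmx_coord_continuous.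
Qed.

Section Convexity.
Variables (R : realFieldType) (E : normedModType R).
Implicit Types (S : set E) (x : E).

Lemma convex_interior_scale S (s : R) x :
  convex_set S -> interior S 0 -> S x -> 0 <= s < 1 -> interior S (s *: x).
Proof.
move=> convS S0 Sx /andP[s_ge0 s_lt1].
pose w y := (1 - s)^-1 *: (y - s *: x).
have w_cvg : w y @[y --> s *: x] --> w (s *: x).
  by apply: cvgZl_tmp; apply: cvgB; [exact: cvg_id|exact: cvg_cst].
have : \forall y \near s *: x, S (w y).
  by apply: w_cvg; rewrite /w subrr scaler0.
apply: filterS => y Sw.
have -> : y = s *: x + (1 - s) *: w y.
  by rewrite /w scalerA divff ?gt_eqF ?subr_gt0// scale1r addrC subrK.
have := convS x (w y) (Itv01 s_ge0 (ltW s_lt1)) (mem_set Sx) (mem_set Sw).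
by move/set_mem.
Qed.

Lemma interior_dilate S x : interior S x -> exists2 t : R, 1 < t & S (t *: x).
Proof.
move=> Sx; have near1_S : \forall t \near (1 : R), S (t *: x).
  by apply: (@scalel_continuous _ _ x 1); rewrite /= scale1r.
near (1 : R)^'+ => t; exists t; near: t.
  exact: nbhs_right_gt.
exact: cvg_within near1_S.
Unshelve. all: by end_near. Qed.

End Convexity.

Section Barrier.
Variable R : realType.

Definition argmin_on (T : Type) (S : set T) (f : T -> R) : set T :=
  [set x | S x /\ forall y, S y -> f x <= f y].

Definition expN_on (T : Type) (S : set T) (f : T -> R) (x : T) : R :=
  if `[< S x >] then expR (- f x) else 0.

Lemma expN_onT (T : Type) (S : set T) (f : T -> R) x :
  S x -> expN_on S f x = expR (- f x).
Proof. by move=> Sx; rewrite /expN_on asboolT. Qed.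

Lemma expN_onF (T : Type) (S : set T) (f : T -> R) x : ~ S x -> expN_on S f x = 0.
Proof. by move=> nSx; rewrite /expN_on asboolF. Qed.

(* Continuity of [expN_on S f] says at once that [S] is open, that [f] is
   continuous on [S] and that [f] tends to infinity at the boundary of [S]. *)
Definition barrier (T : topologicalType) (S : set T) (f : T -> R) : Prop :=
  continuous (expN_on S f).

Section ClosureProperties.
Variable T : topologicalType.
Implicit Types (S : set T) (f g : T -> R).

Lemma barrier_blow_up S f : open S ->
  (forall x, S x -> {for x, continuous f}) ->
  (forall x, ~ S x -> forall M, \forall y \near x, S y -> M < f y) ->
  barrier S f.
Proof.
move=> openS cf f_blow_up x; have [Sx|nSx] := pselect (S x).
  apply: (@near_eq_continuous_at _ _ _ (fun y => expR (- f y))).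
    by apply: filterS (open_nbhs_nbhs (conj openS Sx)) => y Sy; rewrite expN_onT.
  by apply: continuous_cvg; [exact: continuous_expR|apply: cvgN; exact: cf].
rewrite /continuous_at (expN_onF f nSx); apply/cvgrPdist_lt => d d_gt0.
apply: filterS (f_blow_up x nSx (- ln d)) => y f_gt; rewrite sub0r normrN.
have [Sy|nSy] := pselect (S y); last by rewrite expN_onF// normr0.
rewrite expN_onT// gtr0_norm ?expR_gt0// -ltr_ln ?posrE ?expR_gt0// expRK ltrNl.
exact: f_gt.
Qed.

Lemma continuous_barrier f : continuous f -> barrier setT f.
Proof.
move=> cf; apply: barrier_blow_up; first exact: openT.
  by move=> x _; exact: cf.
by move=> x [].
Qed.

Lemma barrier_open S f : barrier S f -> open S.
Proof.
move=> bSf; have -> : S = expN_on S f @^-1` [set r | 0 < r].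
  apply/seteqP; split=> x /=; first by move=> Sx; rewrite expN_onT// expR_gt0.
  by apply: contraPP => nSx; rewrite expN_onF// ltxx.
by apply: open_comp; [move=> x _; exact: bSf|exact: open_gt].
Qed.

Lemma eq_barrier S f g : (forall x, S x -> f x = g x) -> barrier S f -> barrier S g.
Proof.
move=> fg; rewrite /barrier.
have -> // : expN_on S f = expN_on S g.
by apply/funext => x; rewrite /expN_on; case: asboolP => // /fg ->.
Qed.

Lemma barrier_sum (I : finType) (S : I -> set T) (f : I -> T -> R) :
  (forall i, barrier (S i) (f i)) ->
  barrier [set x | forall i, S i x] (fun x => \sum_i f i x).
Proof.
move=> bSf; rewrite /barrier.
have -> : expN_on [set x | forall i, S i x] (fun x => \sum_i f i x) =
    fun x => \prod_i expN_on (S i) (f i) x.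
  apply/funext => x; have [Sx|nSx] := pselect (forall i, S i x).
    by rewrite expN_onT// -sumrN expR_sum; apply: eq_bigr => i _; rewrite expN_onT.
  have /existsNP[i nSix] := nSx.
  by rewrite expN_onF// (bigD1 i)//= expN_onF// mul0r.
by apply: continuous_big => [|i _]; [exact: mul_continuous|exact: bSf].
Qed.

Lemma barrierD S1 S2 f1 f2 : barrier S1 f1 -> barrier S2 f2 ->
  barrier (S1 `&` S2) (fun x => f1 x + f2 x).
Proof.
move=> bSf1 bSf2; rewrite /barrier.
have -> : expN_on (S1 `&` S2) (fun x => f1 x + f2 x) =
    fun x => expN_on S1 f1 x * expN_on S2 f2 x.
  apply/funext => x; rewrite /expN_on asbool_and.
  by do 2!case: asboolP => _; rewrite ?mulr0 ?mul0r// opprD expRD.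
by move=> x; apply: continuousM; [exact: bSf1|exact: bSf2].
Qed.

Lemma barrier_addl_continuous S f g : continuous g -> barrier S f ->
  barrier S (fun x => g x + f x).
Proof. by move=> /continuous_barrier/barrierD /[apply]; rewrite setTI. Qed.

Lemma barrier_argmin S f (K : set T) : compact K -> barrier S f ->
  S `&` K !=set0 -> argmin_on (S `&` K) f !=set0.
Proof.
move=> cK bSf [x0 [Sx0 Kx0]].
have [||x /set_mem Kx x_max] := @compact_EVT_max _ _ (expN_on S f) K _ cK.
- by exists x0.
- exact: continuous_subspaceT.
have Sx : S x.
  apply: contrapT => nSx; have := x_max _ (mem_set Kx0).
  by rewrite (expN_onT _ Sx0) expN_onF// leNgt expR_gt0.
exists x; split=> // y [Sy /mem_set/x_max].
by rewrite !expN_onT// ler_expR lerN2.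
Qed.

End ClosureProperties.

Lemma barrier_comp (T U : topologicalType) (h : T -> U) (S : set U) (f : U -> R) :
  continuous h -> barrier S f -> barrier (h @^-1` S) (f \o h).
Proof. by move=> ch bSf x; exact: continuous_comp (ch x) (bSf (h x)). Qed.

Lemma ln_barrier (e : R) : 0 < e -> barrier [set s : R | 0 < s] (fun s => - (e * ln s)).
Proof.
move=> e_gt0; apply: barrier_blow_up; first exact: open_gt.
  move=> s s_gt0; apply: cvgN; apply: cvgM; first exact: cvg_cst.
  exact: continuous_ln.
move=> s /negP; rewrite -leNgt => s_le0 M; near=> t => t_gt0.
rewrite ltrNr mulrC -ltr_pdivlMr// -ltr_expR lnK//.
near: t; apply: lt_nbhsl; exact: le_lt_trans s_le0 (expR_gt0 _).
Unshelve. all: by end_near. Qed.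

Lemma barrier_scale (T : topologicalType) (S : set T) (f : T -> R) (e : R) :
  0 < e -> barrier S f -> barrier S (fun x => e * f x).
Proof.
move=> e_gt0 bSf; rewrite /barrier.
have -> : expN_on S (fun x => e * f x) =
    expN_on [set s : R | 0 < s] (fun s => - (e * ln s)) \o expN_on S f.
  apply/funext => x /=; have [Sx|nSx] := pselect (S x).
    by rewrite !expN_onT//= ?expR_gt0// expRK mulrN opprK.
  by rewrite (expN_onF _ nSx) [RHS]expN_onF//= (expN_onF f nSx) ltxx.
move=> x; apply: continuous_comp; [exact: bSf|exact: ln_barrier].
Qed.

End Barrier.

Section SmallOnlyNear0.
Variables (R : realType) (E : normedModType R).
Implicit Types (D : set E) (b : E -> R).

Definition small_only_near0 D b : Prop :=
  forall e, 0 < e -> exists2 c, 0 < c & forall x, D x -> b x < c -> `|x| < e.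

Lemma sub_small_only_near0 D1 D2 b :
  D1 `<=` D2 -> small_only_near0 D2 b -> small_only_near0 D1 b.
Proof.
by move=> D12 b_small e /b_small[c c_gt0 b_lt]; exists c => // x /D12; exact: b_lt.
Qed.

Lemma small_only_near0_scale D b (a : R) :
  0 < a -> small_only_near0 D b -> small_only_near0 D (fun x => a * b x).
Proof.
move=> a_gt0 b_small e /b_small[c c_gt0 b_lt].
exists (a * c) => [|x Dx]; first exact: mulr_gt0.
by rewrite ltr_pM2l//; exact: b_lt.
Qed.

End SmallOnlyNear0.

Section LogGap.
Variable R : realType.

Definition log_gap (s : R) : R := s - 1 - ln s.

Lemma log_gap_ge_sqr (s : R) : 0 < s -> (1 - Num.sqrt s) ^+ 2 <= log_gap s.
Proof.
move=> s_gt0; rewrite /log_gap -{2 3}(sqr_sqrtr (ltW s_gt0)).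
set t := Num.sqrt s; have t_gt0 : 0 < t by rewrite sqrtr_gt0.
have : ln (1 + (t - 1)) <= t - 1 by apply: le_ln1Dx; lra.
by rewrite addrC subrK lnXn// mulr2n => ?; nra.
Qed.

Lemma log_gap_ge0 (s : R) : 0 < s -> 0 <= log_gap s.
Proof. by move=> s_gt0; exact: le_trans (sqr_ge0 _) (log_gap_ge_sqr s_gt0). Qed.

Lemma log_gap_lt (s h : R) : 0 < s -> 0 < h ->
  log_gap s < h ^+ 2 / 4 -> 1 - h < s.
Proof.
move=> s_gt0 h_gt0 /(le_lt_trans (log_gap_ge_sqr s_gt0)).
rewrite -{2}(sqr_sqrtr (ltW s_gt0)).
set t := Num.sqrt s; have t_gt0 : 0 < t by rewrite sqrtr_gt0.
have [t_ge1 _|t_lt1 sqr_lt] := leP 1 t; first by nra.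
have : 1 - t < h / 2 by rewrite ltNge; apply/negP => ?; nra.
by move=> ?; nra.
Qed.

Lemma log_gap_barrier : barrier [set s : R | 0 < s] log_gap.
Proof.
apply: (@eq_barrier R R _ (fun s => (s - 1) + - (1 * ln s))).
  by move=> s _; rewrite mul1r.
apply: barrier_addl_continuous; last exact: ln_barrier.
by move=> s; apply: cvgB; [exact: cvg_id|exact: cvg_cst].
Qed.

End LogGap.

Section Polytope.
Variables (R : realType) (q n : nat) (C : 'M[R]_(q, n)) (d : 'cV[R]_q).

Lemma polytope_convex : convex_set (polytope C d).
Proof.
move=> x y t /set_mem Cx /set_mem Cy; apply/mem_set => i.
rewrite mulmxDr -!scalemxAr mxE [X in X + _ <= _]mxE [X in _ + X <= _]mxE.
have -> : d i 0 = t%:num * d i 0 + (1 - t%:num) * d i 0 by ring.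
by apply: lerD; apply: ler_wpM2l; rewrite ?subr_ge0.
Qed.

Lemma polytope_strict_subset : polytope_strict C d `<=` polytope C d.
Proof. by move=> z Cz i; exact: ltW. Qed.

Hypothesis d_gt0 : forall i, 0 < d i 0.

Lemma polytope_strict0 : polytope_strict C d 0.
Proof. by move=> i; rewrite mulmx0 mxE. Qed.

Definition slack (i : 'I_q) (z : 'cV[R]_n) : R := 1 - (C *m z) i 0 / d i 0.

Lemma slack_gt (h : R) i z : (1 - h < slack i z) = ((C *m z) i 0 < h * d i 0).
Proof. by rewrite /slack ltrD2l ltrN2 ltr_pdivrMr. Qed.

Lemma polytope_strictE : polytope_strict C d = [set z | forall i, 0 < slack i z].
Proof.
by apply/seteqP; split=> z Cz i; have := Cz i; rewrite -{1}(subrr 1) slack_gt mul1r.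
Qed.

Lemma slack_continuous i : continuous (slack i).
Proof.
move=> z; apply: (@continuousB _ R _ (fun=> 1) (fun y => (C *m y) i 0 / d i 0)).
  exact: cst_continuous.
by apply: continuousM; [exact: mulmx_coord_continuous|exact: cst_continuous].
Qed.

Lemma weighted_log_gap_barrier (c : 'I_q -> R) : (forall i, 0 < c i) ->
  barrier (polytope_strict C d) (fun z => \sum_i c i * log_gap (slack i z)).
Proof.
move=> c_gt0; rewrite polytope_strictE.
apply: (@barrier_sum _ _ _ (fun i => [set z | 0 < slack i z])) => i.
apply: barrier_scale => //.
exact: barrier_comp (@slack_continuous i) (@log_gap_barrier R).
Qed.

Lemma interior_polytope : interior (polytope C d) = polytope_strict C d.
Proof.
have openS : open (polytope_strict C d).
  exact: barrier_open (@weighted_log_gap_barrier (fun=> 1) (fun=> ltr01)).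
apply/seteqP; split=> [z /interior_dilate[t t_gt1 tP] i|].
  have t_gt0 : 0 < t by apply: lt_trans t_gt1.
  have := tP i; rewrite -scalemxAr mxE -ler_pdivlMl// => /le_lt_trans; apply.
  by rewrite mulrC ltr_pdivrMr// ltr_pMr.
by rewrite -open_subsetE//; exact: polytope_strict_subset.
Qed.

Lemma barB_i_recentered i z : 0 < slack i z ->
  barB_i C d i z - barB_i C d i 0 = - ln (slack i z).
Proof.
move=> s_gt0; rewrite /barB_i mulmx0 [(0 : 'cV_q) i 0]mxE subr0.
have -> : d i 0 - (C *m z) i 0 = d i 0 * slack i z.
  by rewrite /slack mulrBr mulr1 mulrCA divff ?mulr1// gt_eqF.
by rewrite lnM ?posrE//; lra.
Qed.

Lemma grad_barB_i0E i (z : 'cV[R]_n) :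
  ((grad_barB_i0 C d i)^T *m z) 0 0 = 1 - slack i z.
Proof.
rewrite /grad_barB_i0 linearZ /= trmxK -scalemxAl mxE /slack opprB addrC subrK.
by rewrite -row_mul mxE mulrC.
Qed.

(* Both recenterings cancel the linear part, which leaves the same
   form with [c i = 1] (gradient) or [c i = 1 + w i] (weights). *)
Lemma recentered_log_barrierE (Bz : 'cV[R]_n -> R) :
  recentered_log_barrier C d Bz ->
  exists2 c : 'I_q -> R, forall i, 1 <= c i &
    forall z, polytope_strict C d z -> Bz z = \sum_i c i * log_gap (slack i z).
Proof.
rewrite /recentered_log_barrier polytope_strictE => -[BzE|[w [[w_ge0 w_bal] BzE]]].
  exists (fun=> 1) => // z s_gt0; rewrite BzE// /grad_rec_barrier /barB /grad_barB0.
  rewrite -sumrB linear_sum /= mulmx_suml summxE -sumrB; apply: eq_bigr => i _.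
  by rewrite barB_i_recentered// grad_barB_i0E /log_gap; lra.
exists (fun i => 1 + w i 0) => [i|z s_gt0]; first by rewrite lerDl.
have : ((\sum_i (1 + w i 0) *: grad_barB_i0 C d i)^T *m z) 0 0 = 0.
  by rewrite w_bal trmx0 mul0mx mxE.
rewrite linear_sum /= mulmx_suml summxE => bal.
rewrite BzE// -[LHS]subr0 -[X in _ - X]bal /weight_rec_barrier -sumrB.
apply: eq_bigr => i _.
by rewrite barB_i_recentered// linearZ /= -scalemxAl mxE grad_barB_i0E /log_gap; ring.
Qed.

Variable Bz : 'cV[R]_n -> R.
Hypothesis Bz_log : recentered_log_barrier C d Bz.

Lemma recentered_log_barrier_ge i z : polytope_strict C d z ->
  log_gap (slack i z) <= Bz z.
Proof.
have [c c_ge1 BzE] := recentered_log_barrierE Bz_log => zS.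
rewrite BzE// (bigD1 i)//=; move: zS; rewrite polytope_strictE => s_gt0.
have gap_ge0 j : 0 <= log_gap (slack j z) by exact: log_gap_ge0.
have ? j : 0 <= c j by exact: le_trans (c_ge1 j).
by rewrite ler_wpDr ?ler_peMl ?sumr_ge0// => j _; rewrite mulr_ge0.
Qed.

Lemma recentered_log_barrier_ge0 z : polytope_strict C d z -> 0 <= Bz z.
Proof.
have [c c_ge1 BzE] := recentered_log_barrierE Bz_log => zS.
rewrite BzE//; move: zS; rewrite polytope_strictE => s_gt0.
by apply: sumr_ge0 => i _; rewrite mulr_ge0 ?log_gap_ge0// (le_trans _ (c_ge1 i)).
Qed.

Lemma recentered_log_barrier_barrier : barrier (polytope_strict C d) Bz.
Proof.
have [c c_ge1 BzE] := recentered_log_barrierE Bz_log.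
apply: (@eq_barrier _ _ _ (fun z => \sum_i c i * log_gap (slack i z))).
  by move=> z /BzE.
by apply: weighted_log_gap_barrier => i; exact: lt_le_trans (c_ge1 i).
Qed.

(* Small barrier values force [C z <= h d], i.e. [z / h] lies in the polytope. *)
Lemma recentered_log_barrier_small_only_near0 : compact (polytope C d) ->
  small_only_near0 (polytope_strict C d) Bz.
Proof.
move=> /compact_bounded/ex_strict_bound_gt0[r r_gt0 rP] e e_gt0.
pose h := e / r.
have h_gt0 : 0 < h by exact: divr_gt0.
exists (h ^+ 2 / 4) => [|z zS Bz_lt]; first by rewrite divr_gt0// exprn_gt0.
have : polytope C d (h^-1 *: z).
  move=> i; rewrite -scalemxAr mxE ler_pdivrMl// ltW// -slack_gt.
  apply: log_gap_lt => //; first by move: zS; rewrite polytope_strictE.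
  exact: le_lt_trans (recentered_log_barrier_ge i zS) Bz_lt.
by move/rP; rewrite /= normrZ normfV gtr0_norm// ltr_pdivrMl// /h divfK ?gt_eqF.
Qed.

End Polytope.

Lemma cvg0_of_decrease (R : realType) (V b : nat -> R) :
  (forall k, 0 <= V k) -> (forall k, 0 <= b k) ->
  (forall k, V k.+1 <= V k - b k) -> b k @[k --> \oo] --> 0.
Proof.
move=> V_ge0 b_ge0 V_decr.
have /nonincreasing_is_cvgn cV : nonincreasing_seq V.
  by apply/nonincreasing_seqP => k; apply: le_trans (V_decr k) _; rewrite gerBl.
have {}cV : cvgn V by apply: cV; exists 0 => _ [k _ <-].
have cV1 : V k.+1 @[k --> \oo] --> limn V by rewrite cvg_shiftS.
apply: (@squeeze_cvgr _ _ _ _ (fun=> 0) (fun k => V k - V k.+1)).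
- by apply: nearW => k; rewrite b_ge0 /= lerBrDr addrC -lerBrDr.
- exact: cvg_cst.
- by rewrite -[X in _ --> X](subrr (limn V)); apply: cvgB.
Qed.

Definition asymptotically_stable_on (R : realType) (E : normedModType R)
    (D : set E) (g : E -> E) : Prop :=
  [/\ forall x k, D x -> D (iter k g x),
      forall e, 0 < e -> exists2 delta, 0 < delta &
        forall x, D x -> `|x| < delta -> forall k, `|iter k g x| < e &
      forall x, D x -> iter k g x @[k --> \oo] --> (0 : E)].

Section Lyapunov.
Variables (R : realType) (E : normedModType R) (g : E -> E) (D : set E) (V b : E -> R).
Hypothesis D_invariant : forall x, D x -> D (g x).
Hypothesis b_ge0 : forall x, D x -> 0 <= b x.
Hypothesis b_le_V : forall x, D x -> b x <= V x.
Hypothesis V_decrease : forall x, D x -> V (g x) <= V x - b x.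
Hypothesis b_small : small_only_near0 D b.

Let iter_invariant x k : D x -> D (iter k g x).
Proof. by move=> Dx; elim: k => //= k; exact: D_invariant. Qed.

Lemma lyapunov_iter_le x k : D x -> V (iter k g x) <= V x.
Proof.
move=> Dx; elim: k => //= k /(le_trans _); apply.
have Dk := iter_invariant k Dx.
by apply: le_trans (V_decrease Dk) _; rewrite gerBl b_ge0.
Qed.

Lemma lyapunov_attractive x : D x -> iter k g x @[k --> \oo] --> (0 : E).
Proof.
move=> Dx; have Dk k : D (iter k g x) by exact: iter_invariant.
have /cvgrPdist_lt b_cvg0 : b (iter k g x) @[k --> \oo] --> 0.
  apply: (@cvg0_of_decrease _ (fun k => V (iter k g x))) => k.
  - exact: le_trans (b_ge0 (Dk k)) (b_le_V (Dk k)).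
  - exact: b_ge0.
  - exact: V_decrease (Dk k).
apply/cvgrPdist_lt => e /b_small[c c_gt0 b_lt].
apply: filterS (b_cvg0 c c_gt0) => k; rewrite !sub0r !normrN => /ltr_normlW.
exact: b_lt.
Qed.

Lemma lyapunov_asymptotically_stable :
  (forall c, 0 < c -> \forall x \near 0, D x -> V x < c) ->
  asymptotically_stable_on D g.
Proof.
move=> V_small; split=> [x k|e /b_small[c c_gt0 b_lt]|x].
- exact: iter_invariant.
- have /nbhs_ballP[delta /= delta_gt0 V_lt] := V_small c c_gt0.
  exists delta => // x Dx x_lt k; have Dk := iter_invariant k Dx.
  apply: b_lt => //; apply: le_lt_trans (b_le_V Dk) _.
  apply: le_lt_trans (lyapunov_iter_le k Dx) _; apply: V_lt => //.
  by rewrite -ball_normE /= sub0r normrN.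
- exact: lyapunov_attractive.
Qed.

End Lyapunov.

Section OptimalControl.
Variables (R : realType) (X W : Type) (f : X -> W -> X).
Variables (S : set (X * W)) (l : X * W -> R) (Sf : set X) (Vf : X -> R).
Implicit Types (x : X) (w : W) (u v : nat -> W) (N k : nat).

Local Notation shift u := (fun k => u k.+1).

Fixpoint trajectory x u k : X :=
  if k is k'.+1 then f (trajectory x u k') (u k') else x.

Definition feasible N x : set (nat -> W) :=
  [set u | (forall k, (k < N)%N -> S (trajectory x u k, u k)) /\
           Sf (trajectory x u N)].

Definition feasible_states N : set X := [set x | feasible N x !=set0].

Definition horizon_cost N x u : R :=
  \sum_(k < N) l (trajectory x u k, u k) + Vf (trajectory x u N).

Lemma trajectoryS x u k :
  trajectory x u k.+1 = trajectory (f x (u 0%N)) (shift u) k.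
Proof. by elim: k => //= k ->. Qed.

Lemma feasibleS N x u :
  feasible N.+1 x u <-> S (x, u 0%N) /\ feasible N (f x (u 0%N)) (shift u).
Proof.
split=> [[Su Sfu]|[S0 [Su Sfu]]].
  split; first exact: (Su 0%N).
  by split=> [k kN|]; rewrite -trajectoryS //; exact: Su.
split=> [[|k] kN //|]; rewrite trajectoryS //; exact: Su.
Qed.

Lemma horizon_costS N x u : horizon_cost N.+1 x u =
  l (x, u 0%N) + horizon_cost N (f x (u 0%N)) (shift u).
Proof.
rewrite /horizon_cost big_ord_recl trajectoryS -addrA; congr (_ + (_ + _)).
by apply: eq_bigr => k _; rewrite lift0 trajectoryS.
Qed.

Lemma eq_trajectory N x u v : (forall k, (k < N)%N -> u k = v k) ->
  forall k, (k <= N)%N -> trajectory x u k = trajectory x v k.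
Proof.
by move=> uv; elim=> //= k IH kN; rewrite uv// IH// ltnW.
Qed.

Lemma eq_feasible N x u v : (forall k, (k < N)%N -> u k = v k) ->
  feasible N x u -> feasible N x v.
Proof.
move=> uv [Su Sfu]; split=> [k kN|]; last by rewrite -(eq_trajectory x uv).
by rewrite -(eq_trajectory x uv) ?(ltnW kN)// -uv//; exact: Su.
Qed.

Lemma eq_horizon_cost N x u v : (forall k, (k < N)%N -> u k = v k) ->
  horizon_cost N x u = horizon_cost N x v.
Proof.
move=> uv; rewrite /horizon_cost (eq_trajectory x uv)//; congr (_ + _).
by apply: eq_bigr => k _; rewrite (eq_trajectory x uv) ?uv// ltnW.
Qed.

Section TerminalController.
Variable kappa : X -> W.
Hypothesis terminal_decrease : forall x, Sf x ->
  [/\ S (x, kappa x), Sf (f x (kappa x)) &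
      l (x, kappa x) + Vf (f x (kappa x)) <= Vf x].

Lemma extend_horizon N x u : feasible N x u ->
  exists2 v, feasible N.+1 x v & horizon_cost N.+1 x v <= horizon_cost N x u.
Proof.
elim: N x u => [|N IH] x u.
  move=> [_ /terminal_decrease[Sx SfSx decr]]; exists (fun=> kappa x).
    by apply/feasibleS.
  by rewrite horizon_costS /horizon_cost !big_ord0 !add0r.
move=> /feasibleS[S0 /IH[v fv cost_le]].
exists (fun k => if k is k'.+1 then v k' else u 0%N); first exact/feasibleS.
by rewrite [leLHS]horizon_costS [leRHS]horizon_costS lerD2l.
Qed.

Lemma terminal_cost_bound N x : Sf x ->
  exists2 u, feasible N x u & horizon_cost N x u <= Vf x.
Proof.
move=> Sfx; elim: N => [|N [u fu cost_le]].
  by exists (fun=> kappa x); rewrite ?/horizon_cost ?big_ord0 ?add0r.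
have [v fv /le_trans le_v] := extend_horizon fu.
by exists v => //; exact: le_v.
Qed.

Lemma shift_and_extend N x u : feasible N.+1 x u ->
  exists2 v, feasible N.+1 (f x (u 0%N)) v &
    horizon_cost N.+1 (f x (u 0%N)) v <= horizon_cost N.+1 x u - l (x, u 0%N).
Proof.
move=> /feasibleS[_ /extend_horizon[v fv cost_le]].
by exists v => //; rewrite (horizon_costS N x) addrAC subrr add0r.
Qed.

Section RecedingHorizon.
Variables (N : nat) (b : X -> R) (mu : X -> nat -> W).
Hypothesis Vf_ge0 : forall x, Sf x -> 0 <= Vf x.
Hypothesis b_ge0 : forall x w, S (x, w) -> 0 <= b x.
Hypothesis b_le_l : forall x w, S (x, w) -> b x <= l (x, w).
Hypothesis mu_optimal : forall x, feasible_states N.+1 x ->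
  argmin_on (feasible N.+1 x) (horizon_cost N.+1 x) (mu x).

Definition closed_loop x : X := f x (mu x 0%N).
Definition value x : R := horizon_cost N.+1 x (mu x).

Lemma receding_horizon_stage x : feasible_states N.+1 x -> S (x, mu x 0%N).
Proof. by case/mu_optimal=> /feasibleS[]. Qed.

Lemma value_le x u : feasible N.+1 x u -> value x <= horizon_cost N.+1 x u.
Proof. by move=> fu; apply: (mu_optimal _).2 => //; exists u. Qed.

Lemma closed_loop_feasible x :
  feasible_states N.+1 x -> feasible_states N.+1 (closed_loop x).
Proof. by case/mu_optimal=> /shift_and_extend[v fv _] _; exists v. Qed.

Lemma value_decrease x :
  feasible_states N.+1 x -> value (closed_loop x) <= value x - b x.
Proof.
move=> fx; have [/shift_and_extend[v fv cost_le] _] := mu_optimal fx.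
apply: le_trans (value_le fv) (le_trans cost_le _).
by rewrite lerD2l lerN2; exact: b_le_l (receding_horizon_stage fx).
Qed.

Lemma le_value x : feasible_states N.+1 x -> b x <= value x.
Proof.
move=> /mu_optimal[[S_mu Sf_mu] _]; rewrite /value /horizon_cost big_ord_recl -addrA.
apply: le_trans (b_le_l (S_mu 0%N isT)) _; rewrite lerDl addr_ge0 ?Vf_ge0//.
apply: sumr_ge0 => k _; have S_k := S_mu (lift ord0 k) (ltn_ord _).
exact: le_trans (b_ge0 S_k) (b_le_l S_k).
Qed.

Lemma value_le_terminal x : Sf x -> value x <= Vf x.
Proof.
by move=> /(terminal_cost_bound N.+1)[u fu]; exact: le_trans (value_le fu).
Qed.

End RecedingHorizon.

End TerminalController.

End OptimalControl.

Theorem receding_horizon_asymptotically_stable (R : realType) (E : normedModType R)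
    (W : Type) (f : E -> W -> E) (S : set (E * W)) (l : E * W -> R)
    (Sf : set E) (Vf : E -> R) (N : nat) (kappa : E -> W) (b : E -> R)
    (mu : E -> nat -> W) :
  (forall x, Sf x ->
     [/\ S (x, kappa x), Sf (f x (kappa x)) &
         l (x, kappa x) + Vf (f x (kappa x)) <= Vf x]) ->
  (forall x, Sf x -> 0 <= Vf x) ->
  (forall x w, S (x, w) -> 0 <= b x) ->
  (forall x w, S (x, w) -> b x <= l (x, w)) ->
  (forall x, feasible_states f S Sf N.+1 x ->
     argmin_on (feasible f S Sf N.+1 x) (horizon_cost f l Vf N.+1 x) (mu x)) ->
  small_only_near0 (feasible_states f S Sf N.+1) b ->
  nbhs 0 Sf -> {for 0, continuous Vf} -> Vf 0 = 0 ->
  asymptotically_stable_on (feasible_states f S Sf N.+1) (closed_loop f mu).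
Proof.
move=> terminal_decrease Vf_ge0 b_ge0 b_le_l mu_optimal b_small Sf0 Vf_cont Vf0.
apply: (lyapunov_asymptotically_stable (V := value f l Vf N mu) (b := b)) => //.
- exact: (closed_loop_feasible terminal_decrease mu_optimal).
- by move=> x /(receding_horizon_stage mu_optimal)/b_ge0.
- exact: (le_value Vf_ge0 b_ge0 b_le_l mu_optimal).
- exact: (value_decrease terminal_decrease b_le_l mu_optimal).
move=> c c_gt0; have Vf_lt : \forall x \near 0, Vf x < c.
  by apply: (cvgr_lt _ Vf_cont); rewrite Vf0.
apply: filterS2 Sf0 Vf_lt => x Sfx Vf_lt _.
exact: le_lt_trans (value_le_terminal terminal_decrease mu_optimal Sfx) Vf_lt.
Qed.

Section OptimalInput.
Variables (R : realType) (X W : topologicalType) (f : X -> W -> X).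
Variables (S : set (X * W)) (l : X * W -> R) (Sf : set X) (Vf : X -> R).
Hypothesis f_continuous : continuous (fun z : X * W => f z.1 z.2).

Lemma trajectory_continuous (T : topologicalType) (x : T -> X) (u : T -> nat -> W) k :
  continuous x -> (forall k, continuous (fun t => u t k)) ->
  continuous (fun t => trajectory f (x t) (u t) k).
Proof.
move=> cx cu; elim: k => //= k IH t.
exact: continuous2_cvg (@f_continuous (_, _)) (IH t) (cu k t).
Qed.

Lemma feasible_states_open N : open S -> open Sf -> open (feasible_states f S Sf N).
Proof.
move=> openS openSf; rewrite openE => x [u [Su Sfu]].
have traj_cvg k : trajectory f y u k @[y --> x] --> trajectory f x u k.
  apply: (@trajectory_continuous X id (fun=> u)) => [y|i]; first exact: cvg_id.
  exact: cst_continuous.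
have near_S : \forall y \near x, forall k : 'I_N, S (trajectory f y u k, u k).
  apply: filter_forall => k.
  have pair_cvg : (trajectory f y u k, u k) @[y --> x] --> (trajectory f x u k, u k).
    by apply: cvg_pair; [exact: traj_cvg|exact: cvg_cst].
  by apply: pair_cvg; apply: open_nbhs_nbhs; split=> //; exact: Su.
have near_Sf : \forall y \near x, Sf (trajectory f y u N).
  by apply: traj_cvg; exact: open_nbhs_nbhs.
apply: filterS2 near_S near_Sf => y S_y Sf_y; exists u; split=> // k kN.
exact: S_y (Ordinal kN).
Qed.

Hypothesis l_barrier : barrier S l.
Hypothesis Vf_barrier : barrier Sf Vf.

Lemma horizon_cost_barrier (T : topologicalType) (x : T -> X) (u : T -> nat -> W) N :
  continuous x -> (forall k, continuous (fun t => u t k)) ->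
  barrier [set t | feasible f S Sf N (x t) (u t)]
    (fun t => horizon_cost f l Vf N (x t) (u t)).
Proof.
move=> cx cu; have ctraj k := @trajectory_continuous T x u k cx cu.
have -> : [set t | feasible f S Sf N (x t) (u t)] =
    [set t | forall k : 'I_N, S (trajectory f (x t) (u t) k, u t k)] `&`
    [set t | Sf (trajectory f (x t) (u t) N)].
  apply/seteqP; split=> t [St Sft]; split=> // k; first exact: St.
  by move=> kN; exact: (St (Ordinal kN)).
apply: barrierD; last exact: barrier_comp (ctraj N) Vf_barrier.
apply: (@barrier_sum _ _ _
  (fun k : 'I_N => [set t | S (trajectory f (x t) (u t) k, u t k)])) => k.
apply: (barrier_comp _ l_barrier) => t.
by apply: cvg_pair; [exact: ctraj|exact: cu].
Qed.

Local Notation input_sequence := (prod_topology (fun _ : nat => W)).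

Lemma exists_optimal_input N x (KW : set W) :
  compact KW -> KW !=set0 -> (forall y w, S (y, w) -> KW w) ->
  feasible_states f S Sf N x ->
  argmin_on (feasible f S Sf N x) (horizon_cost f l Vf N x) !=set0.
Proof.
move=> cKW [w0 KWw0] S_KW [u0 fu0].
pose trunc u k := if (k < N)%N then u k else w0.
have truncE u k : (k < N)%N -> u k = trunc u k by rewrite /trunc => ->.
pose KWs : set input_sequence := [set u | forall k, KW (u k)].
have trunc_KWs u : feasible f S Sf N x u -> KWs (trunc u).
  by move=> [Su _] k; rewrite /trunc; case: ifP => // /Su/S_KW.
have trunc_feasible u : feasible f S Sf N x u -> feasible f S Sf N x (trunc u).
  exact: eq_feasible (truncE u).
have cKWs : compact KWs by exact: (@tychonoff nat (fun=> W) (fun=> KW)).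
have cost_barrier : barrier (feasible f S Sf N x : set input_sequence)
    (horizon_cost f l Vf N x).
  apply: (@horizon_cost_barrier input_sequence (fun=> x) id).
    exact: cst_continuous.
  by move=> k; exact: (@proj_continuous nat (fun=> W) k).
have [|u [[fu _] u_min]] := barrier_argmin cKWs cost_barrier.
  by exists (trunc u0); split; [exact: trunc_feasible|exact: trunc_KWs].
exists u; split=> // v fv; rewrite (eq_horizon_cost _ _ _ _ (truncE v)).
by apply: u_min; split; [exact: trunc_feasible|exact: trunc_KWs].
Qed.

End OptimalInput.

Section ExtendedCost.
Variable R : realType.

Lemma extD (T : Type) (S1 S2 : set T) (f1 f2 : T -> R) (z : T) :
  (ext S1 f1 z + ext S2 f2 z)%E = ext (S1 `&` S2) (fun y => f1 y + f2 y) z.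
Proof. by rewrite /ext asbool_and; do 2!case: asboolP. Qed.

Lemma ext_sum (T : Type) (N : nat) (S : nat -> set T) (f : nat -> T -> R) (z : T) :
  (\sum_(k < N) ext (S k) (f k) z)%E =
  ext [set y | forall k, (k < N)%N -> S k y] (fun y => \sum_(k < N) f k y) z.
Proof.
elim: N => [|N IH]; first by rewrite /ext asboolT// !big_ord0.
rewrite big_ord_recr/= IH extD /ext big_ord_recr/=; congr (if _ then _ else _).
apply: asbool_equiv_eq; split=> [[SN SNN] k|SN].
  by rewrite ltnS leq_eqVlt => /predU1P[->|/SN].
by split=> [k kN|]; apply: SN; rewrite // ltnW.
Qed.

Lemma ext_affine (T : Type) (S : set T) (f g : T -> R) (e : R) (z : T) :
  0 < e -> ((g z)%:E + e%:E * ext S f z)%E = ext S (fun y => g y + e * f y) z.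
Proof. by move=> e_gt0; rewrite /ext; case: asboolP; rewrite // gt0_muley. Qed.

Lemma ext_argminP (T : Type) (S : set T) (f : T -> R) (x : T) : S !=set0 ->
  (forall y, (ext S f x <= ext S f y)%E) <-> argmin_on S f x.
Proof.
move=> [x0 Sx0]; split=> [x_min|[Sx x_min] y]; last first.
  by rewrite /ext asboolT//; case: asboolP => [/x_min|_]; rewrite ?lee_fin ?leey.
have Sx : S x by have := x_min x0; rewrite /ext (asboolT Sx0); case: asboolP.
by split=> // y Sy; have := x_min y; rewrite /ext !asboolT.
Qed.

Lemma ext_horizon_cost (X W : Type) (f : X -> W -> X) (S : set (X * W))
    (l : X * W -> R) (Sf : set X) (Vf : X -> R) (N : nat) (x : X) (u : nat -> W) :
  (\sum_(k < N) ext S l (trajectory f x u k, u k) + ext Sf Vf (trajectory f x u N))%E =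
  ext (feasible f S Sf N x) (horizon_cost f l Vf N x) u.
Proof.
have sumE := ext_sum N (fun k => [set v | S (trajectory f x v k, v k)])
  (fun k v => l (trajectory f x v k, v k)) u.
apply: etrans (congr1 (fun s => s + _)%E sumE) _.
exact: (extD _ [set v | Sf (trajectory f x v N)] _
               (fun v => Vf (trajectory f x v N)) u).
Qed.

End ExtendedCost.

Section QuadraticForm.
Variables (R : realType) (n : nat).

Lemma qf0 (P : 'M[R]_n) : qf P 0 = 0.
Proof. by rewrite /qf mulmx0 mxE. Qed.

Lemma pd_qf_ge0 (P : 'M[R]_n) x : pd P -> 0 <= qf P x.
Proof. by case=> _ P_gt0; have [->|/P_gt0/ltW//] := eqVneq x 0; rewrite qf0. Qed.

Lemma qf_lyapunov_equation (m : nat) (P Q M AK : 'M[R]_n) (Rw : 'M[R]_m)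
    (K : 'M[R]_(m, n)) (eps : R) (x : 'cV[R]_n) :
  P = AK^T *m P *m AK + K^T *m Rw *m K + Q + eps *: M ->
  qf P x = qf P (AK *m x) + qf Rw (K *m x) + qf Q x + eps * qf M x.
Proof.
move=> PE.
have qfD (S T : 'M[R]_n) : qf (S + T) x = qf S x + qf T x.
  by rewrite /qf mulmxDr mulmxDl mxE.
have qfT k (L : 'M[R]_(k, n)) S : qf (L^T *m S *m L) x = qf S (L *m x).
  by rewrite /qf trmx_mul !mulmxA.
rewrite {1}PE !qfD !qfT; congr (_ + _).
by rewrite /qf -scalemxAr -scalemxAl mxE.
Qed.

End QuadraticForm.

Lemma recentered_barrier_barrier (R : realType) (n : nat) (Xf : set 'cV[R]_n)
    (Bf : 'cV[R]_n -> R) :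
  recentered_barrier Xf Bf -> barrier (interior Xf) Bf.
Proof.
case=> _ _ _ [Bf_diff _] Bf_boundary; apply: barrier_blow_up.
- exact: open_interior.
- by move=> x /Bf_diff; exact: differentiable_continuous.
move=> x nXf M; have [cx|/existsNP[V /not_implyP[Vx XfV]]] := pselect (closure Xf x).
  have [e e_gt0 Bf_gt] := Bf_boundary x (conj cx nXf) M.
  by apply/nbhs_ballP; exists e => //= y xy /Bf_gt; exact.
apply: filterS Vx => y Vy /interior_subset Xfy.
by exfalso; apply: XfV; exists y.
Qed.

Section LinearSystem.
Variables (R : realType) (n m : nat) (A : 'M[R]_n) (B : 'M[R]_(n, m)).

Definition linear_step (x : 'cV[R]_n) (w : 'cV[R]_m) : 'cV[R]_n := A *m x + B *m w.

Lemma linear_step_continuous : continuous (fun z => linear_step z.1 z.2).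
Proof.
move=> z; apply: cvgD; apply: continuous_cvg.
- exact: mulmx_continuous.
- exact: cvg_fst.
- exact: mulmx_continuous.
- exact: cvg_snd.
Qed.

Lemma pred_stateE x u k : pred_state A B x u k = trajectory linear_step x u k.
Proof. by elim: k => //= k ->. Qed.

Lemma cl_stateE mu :
  cl_state A B mu = fun x k => iter k (closed_loop linear_step mu) x.
Proof. by apply/funext => x; apply/funext; elim=> //= k ->. Qed.

Lemma linear_trajectory_scale (s : R) x u k :
  trajectory linear_step (s *: x) (fun k => s *: u k) k =
  s *: trajectory linear_step x u k.
Proof. by elim: k => //= k ->; rewrite /linear_step -!scalemxAr -scalerDr. Qed.

(* A state in the interior is [t^-1 *: (t *: x)] with [t > 1] and [t *: x] still
   feasible; scaling back by [t^-1] makes all the constraints strict. *)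
Lemma interior_feasible_set (X Xf : set 'cV[R]_n) (U : set 'cV[R]_m) (N : nat) :
  (0 < N)%N -> convex_set X -> convex_set U -> convex_set Xf ->
  interior X 0 -> interior U 0 -> interior Xf 0 ->
  interior (feasible_set N A B X U Xf) =
  feasible_states linear_step (interior X `*` interior U) (interior Xf) N.
Proof.
move=> N_gt0 cvxX cvxU cvxXf X0 U0 Xf0.
apply/seteqP; split=> [x /interior_dilate[t t_gt1 [_ [u [XUu Xfu]]]]|].
  have t_gt0 : 0 < t by apply: lt_trans t_gt1.
  have tV_lt1 : 0 <= t^-1 < 1 by rewrite invr_ge0 ltW//= invf_lt1.
  exists (fun k => t^-1 *: u k); rewrite -[x](scalerK (lt0r_neq0 t_gt0)).
  split=> [k /XUu[Uu Xu]|]; rewrite linear_trajectory_scale -pred_stateE.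
    by split; exact: convex_interior_scale.
  exact: convex_interior_scale.
rewrite -open_subsetE => [x [u [XUu Xfu]]|].
  have UXu k : (k < N)%N -> U (u k) /\ X (pred_state A B x u k).
    by rewrite pred_stateE => /XUu[/interior_subset Xk /interior_subset Uk].
  split; first exact: (UXu 0%N N_gt0).2.
  by exists u; split=> //; rewrite pred_stateE; exact: interior_subset.
apply: feasible_states_open; first exact: linear_step_continuous.
  by apply: open_setX; exact: open_interior.
exact: open_interior.
Qed.

End LinearSystem.

Section BarrierMPC.
Variables (R : realType) (n m qx qu : nat) (A : 'M[R]_n) (B : 'M[R]_(n, m)).
Variables (Cx : 'M[R]_(qx, n)) (dx : 'cV[R]_qx) (Cu : 'M[R]_(qu, m)) (du : 'cV[R]_qu).
Variables (Q : 'M[R]_n) (Rw : 'M[R]_m) (P : 'M[R]_n) (eps : R).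
Variables (Xf : set 'cV[R]_n).
Variables (Bx : 'cV[R]_n -> R) (Bu : 'cV[R]_m -> R) (Bf : 'cV[R]_n -> R).
Hypothesis eps_gt0 : 0 < eps.

Local Notation step := (linear_step A B).
Local Notation Sx := (polytope_strict Cx dx).
Local Notation Su := (polytope_strict Cu du).
Local Notation Sf := (interior Xf).

Definition stage_cost (z : 'cV[R]_n * 'cV[R]_m) : R :=
  qf Q z.1 + qf Rw z.2 + eps * Bu z.2 + eps * Bx z.1.

Definition terminal_cost (x : 'cV[R]_n) : R := qf P x + eps * Bf x.

Lemma ext_stage_cost (x : 'cV[R]_n) (w : 'cV[R]_m) :
  ((qf Q x + qf Rw w)%:E + eps%:E * ext Su Bu w + eps%:E * ext Sx Bx x)%E =
  ext (Sx `*` Su) stage_cost (x, w).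
Proof.
rewrite /ext asbool_and /=.
by do 2!case: asboolP => _; rewrite ?[(_ * +oo)%E]gt0_muley.
Qed.

Lemma stage_cost_barrier : barrier Sx Bx -> barrier Su Bu ->
  barrier (Sx `*` Su) stage_cost.
Proof.
move=> Bx_barrier Bu_barrier.
pose quadratic (z : 'cV[R]_n * 'cV[R]_m) := qf Q z.1 + qf Rw z.2.
apply: (@eq_barrier _ _ _ (fun z => quadratic z + (eps * Bx z.1 + eps * Bu z.2))).
  by move=> z _; rewrite /stage_cost /quadratic; ring.
apply: barrier_addl_continuous.
  move=> z; apply: cvgD; apply: continuous_cvg.
  - exact: qf_continuous.
  - exact: cvg_fst.
  - exact: qf_continuous.
  - exact: cvg_snd.
apply: (@barrierD _ _ (fst @^-1` Sx) (snd @^-1` Su)).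
  by apply: (barrier_comp _ (barrier_scale eps_gt0 Bx_barrier)) => z; exact: cvg_fst.
by apply: (barrier_comp _ (barrier_scale eps_gt0 Bu_barrier)) => z; exact: cvg_snd.
Qed.

Lemma terminal_cost_barrier : barrier Sf Bf -> barrier Sf terminal_cost.
Proof.
move=> /(barrier_scale eps_gt0); apply: barrier_addl_continuous.
exact: qf_continuous.
Qed.

Lemma stage_cost_ge x w :
  psd Q -> pd Rw -> 0 <= Bu w -> eps * Bx x <= stage_cost (x, w).
Proof.
move=> [_ /(_ x) Q_ge0] /(@pd_qf_ge0 _ _ _ w) Rw_ge0 Bu_ge0.
by rewrite /stage_cost lerDr !addr_ge0// mulr_ge0// ltW.
Qed.

Lemma terminal_decrease (K : 'M[R]_(m, n)) (M : 'M[R]_n) (x : 'cV[R]_n) :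
  P = (A + B *m K)^T *m P *m (A + B *m K) + K^T *m Rw *m K + Q + eps *: M ->
  (ext Sx Bx x + ext Su Bu (K *m x) <= (qf M x)%:E)%E ->
  (ext Sf Bf ((A + B *m K) *m x) <= ext Sf Bf x)%E -> Sf x ->
  [/\ (Sx `*` Su) (x, K *m x), Sf (step x (K *m x)) &
      stage_cost (x, K *m x) + terminal_cost (step x (K *m x)) <= terminal_cost x].
Proof.
move=> P_lyapunov B_le_M Bf_decr Sfx.
have -> : step x (K *m x) = (A + B *m K) *m x by rewrite /linear_step mulmxA -mulmxDl.
move: B_le_M Bf_decr; rewrite /ext (asboolT Sfx).
case: asboolP => // Sxx; case: asboolP => // Sux; case: asboolP => // SfAK.
rewrite -EFinD !lee_fin => B_le_M Bf_le; split=> //.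
rewrite /stage_cost /terminal_cost (qf_lyapunov_equation x P_lyapunov) /=.
have := ler_wpM2l (ltW eps_gt0) B_le_M; have := ler_wpM2l (ltW eps_gt0) Bf_le.
by rewrite mulrDr; lra.
Qed.

Local Notation states N := (feasible_states step (Sx `*` Su) Sf N).
Local Notation inputs N := (feasible step (Sx `*` Su) Sf N).
Local Notation cost N := (horizon_cost step stage_cost terminal_cost N).
Local Notation J N := (barrier_cost N A B Cx dx Cu du Q Rw P eps Bx Bu Xf Bf).

Lemma barrier_costE N x : J N x = ext (inputs N x) (cost N x).
Proof.
apply/funext => u; rewrite -ext_horizon_cost /barrier_cost -addeA ext_affine//.
by congr (_ + _)%E; [apply: eq_bigr => k _; rewrite ext_stage_cost|];
  rewrite pred_stateE.
Qed.

Lemma barrier_cost_minP N x u : states N x ->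
  (forall v, (J N x u <= J N x v)%E) <-> argmin_on (inputs N x) (cost N x) u.
Proof. by rewrite barrier_costE; exact: ext_argminP. Qed.

Hypothesis dx_gt0 : forall i, 0 < dx i 0.
Hypothesis du_gt0 : forall i, 0 < du i 0.
Hypothesis Bx_log : recentered_log_barrier Cx dx Bx.
Hypothesis Bu_log : recentered_log_barrier Cu du Bu.
Hypothesis Bf_rec : recentered_barrier Xf Bf.

Lemma interior_polytopic_feasible_set N : (0 < N)%N -> convex_set Xf ->
  interior (feasible_set N A B (polytope Cx dx) (polytope Cu du) Xf) = states N.
Proof.
move=> N_gt0 Xf_convex; have [[Xf0 _] _ _ _ _] := Bf_rec.
rewrite interior_feasible_set ?interior_polytope//; try exact: polytope_convex.
  exact: polytope_strict0.
exact: polytope_strict0.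
Qed.

Lemma exists_barrier_cost_minimizer N x : compact (polytope Cu du) -> states N x ->
  exists u, (J N x u < +oo)%E /\ forall v, (J N x u <= J N x v)%E.
Proof.
move=> U_compact x_feasible.
have Sx_barrier := recentered_log_barrier_barrier dx_gt0 Bx_log.
have Su_barrier := recentered_log_barrier_barrier du_gt0 Bu_log.
have Sf_barrier := recentered_barrier_barrier Bf_rec.
have [||u u_opt] := exists_optimal_input (@linear_step_continuous _ _ _ A B)
  (stage_cost_barrier Sx_barrier Su_barrier) (terminal_cost_barrier Sf_barrier)
  U_compact _ _ x_feasible.
- by exists 0; exact/polytope_strict_subset/polytope_strict0.
- by move=> y w [_ /polytope_strict_subset].
exists u; split; last exact/(barrier_cost_minP _ x_feasible).
by rewrite barrier_costE /ext asboolT ?ltry//; case: u_opt.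
Qed.

Section ClosedLoop.
Variables (K : 'M[R]_(m, n)) (M : 'M[R]_n).
Hypothesis Q_psd : psd Q.
Hypothesis Rw_pd : pd Rw.
Hypothesis P_pd : pd P.
Hypothesis X_compact : compact (polytope Cx dx).
Hypothesis P_lyapunov :
  P = (A + B *m K)^T *m P *m (A + B *m K) + K^T *m Rw *m K + Q + eps *: M.
Hypothesis Bx_Bu_le : forall x, Sf x ->
  (ext Sx Bx x + ext Su Bu (K *m x) <= (qf M x)%:E)%E.
Hypothesis Bf_decrease : forall x, Sf x ->
  (ext Sf Bf ((A + B *m K) *m x) <= ext Sf Bf x)%E.

Variables (N : nat) (mu : 'cV[R]_n -> nat -> 'cV[R]_m).
Hypothesis mu_minimizes : forall x, states N.+1 x ->
  forall v, (J N.+1 x (mu x) <= J N.+1 x v)%E.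

Let mu_optimal x : states N.+1 x -> argmin_on (inputs N.+1 x) (cost N.+1 x) (mu x).
Proof.
by move=> x_feasible; apply/barrier_cost_minP => // v; exact: mu_minimizes.
Qed.

Let eps_Bx_ge0 x : Sx x -> 0 <= eps * Bx x.
Proof.
by move=> Sxx; apply: mulr_ge0; [exact: ltW|exact: recentered_log_barrier_ge0 Sxx].
Qed.

Let terminal_cost_ge0 x : Sf x -> 0 <= terminal_cost x.
Proof.
have [_ Bf_ge0 _ _ _] := Bf_rec.
move=> /Bf_ge0 Bfx_ge0; apply: addr_ge0; first exact: pd_qf_ge0.
by apply: mulr_ge0 => //; exact: ltW.
Qed.

Let terminal_cost_continuous0 : {for 0, continuous terminal_cost}.
Proof.
have [[Xf0 _] _ _ [Bf_diff _] _] := Bf_rec.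
apply: (@continuousD R _ _ (qf P) (fun x => eps * Bf x)).
  exact: qf_continuous.
apply: (@continuousM _ _ (fun=> eps) Bf); first exact: cst_continuous.
exact: differentiable_continuous (Bf_diff _ Xf0).
Qed.

Let eps_Bx_small : small_only_near0 (states N.+1) (fun x => eps * Bx x).
Proof.
apply: small_only_near0_scale => //.
apply: (@sub_small_only_near0 _ _ _ Sx) => [x [u /feasibleS[[]]]//|].
exact: recentered_log_barrier_small_only_near0.
Qed.

Lemma barrier_mpc_strict x : states N.+1 x -> (Sx `*` Su) (x, mu x 0%N).
Proof. exact: (receding_horizon_stage mu_optimal). Qed.

Lemma barrier_mpc_asymptotically_stable :
  asymptotically_stable_on (states N.+1) (closed_loop step mu).
Proof.
have [[Xf0 Bf0] _ _ _ _] := Bf_rec.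
apply: (@receding_horizon_asymptotically_stable _ _ _ step (Sx `*` Su) stage_cost
  Sf terminal_cost N (mulmx K) (fun x => eps * Bx x) mu).
- move=> x Sfx.
  exact: terminal_decrease P_lyapunov (Bx_Bu_le Sfx) (Bf_decrease Sfx) Sfx.
- exact: terminal_cost_ge0.
- by move=> x w [Sxx _]; exact: eps_Bx_ge0.
- move=> x w [_ Suw]; apply: stage_cost_ge => //.
  exact: recentered_log_barrier_ge0 Suw.
- exact: mu_optimal.
- exact: eps_Bx_small.
- by apply: open_nbhs_nbhs; split=> //; exact: open_interior.
- exact: terminal_cost_continuous0.
- by rewrite /terminal_cost qf0 Bf0 mulr0 addr0.
Qed.

End ClosedLoop.

End BarrierMPC.

Theorem theorem1 (R : realType) (n m qx qu N : nat)
  (A : 'M[R]_n) (B : 'M[R]_(n, m))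
  (Cx : 'M[R]_(qx, n)) (dx : 'cV[R]_qx) (Cu : 'M[R]_(qu, m)) (du : 'cV[R]_qu)
  (Q : 'M[R]_n) (Rw : 'M[R]_m) (eps : R)
  (K : 'M[R]_(m, n)) (M P : 'M[R]_n)
  (Nset Xf : set 'cV[R]_n)
  (Bx : 'cV[R]_n -> R) (Bu : 'cV[R]_m -> R) (Bf : 'cV[R]_n -> R) :
  (* constraint sets: compact polytopes with strictly positive d *)
  (forall i, 0 < dx i 0) -> (forall i, 0 < du i 0) ->
  compact (polytope Cx dx) -> compact (polytope Cu du) ->
  (* cost, horizon, barrier weight *)
  psd Q -> pd Rw -> (0 < N)%N -> 0 < eps ->
  (* stabilizing gain *)
  schur (A + B *m K) ->
  (* (A1) *)
  recentered_log_barrier Cx dx Bx -> recentered_log_barrier Cu du Bu ->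
  (* (A2) *)
  psd M -> convex_set Nset -> compact Nset -> interior Nset 0 ->
  (forall x, Nset x -> polytope Cx dx x /\ polytope Cu du (K *m x)) ->
  (forall x, Nset x ->
     (ext (polytope_strict Cx dx) Bx x + ext (polytope_strict Cu du) Bu (K *m x)
        <= (qf M x)%:E)%E) ->
  (* (A3) *)
  pd P ->
  P = (A + B *m K)^T *m P *m (A + B *m K) + K^T *m Rw *m K + Q + eps *: M ->
  (* (A4) *)
  convex_set Xf -> compact Xf -> Xf 0 -> Xf `<=` Nset ->
  (forall x, Xf x -> Xf ((A + B *m K) *m x)) ->
  (* (A5) *)
  recentered_barrier Xf Bf ->
  (forall x, interior Xf x ->
     (ext (interior Xf) Bf ((A + B *m K) *m x) <= ext (interior Xf) Bf x)%E) ->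
  (* X_N has nonempty interior *)
  let XN := feasible_set N A B (polytope Cx dx) (polytope Cu du) Xf in
  let J := barrier_cost N A B Cx dx Cu du Q Rw P eps Bx Bu Xf Bf in
  interior XN !=set0 ->
  (* the barrier-based problem has a (finite) minimizer on the interior of X_N *)
  (forall x, interior XN x ->
     exists u, (J x u < +oo)%E /\ forall v, (J x u <= J x v)%E) /\
  (* and for any minimizer map ustar, the MPC feedback u(k) = ustar(x(k))_0 ... *)
  (forall ustar : 'cV[R]_n -> nat -> 'cV[R]_m,
     (forall x, interior XN x -> forall v, (J x (ustar x) <= J x v)%E) ->
     let xcl := cl_state A B ustar in
     (* recursive feasibility and strict constraint satisfaction *)
     (forall x0, interior XN x0 -> forall k,
        [/\ interior XN (xcl x0 k),
            polytope_strict Cx dx (xcl x0 k) &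
            polytope_strict Cu du (ustar (xcl x0 k) 0%N)]) /\
     (* Lyapunov stability of the origin *)
     (forall e : R, 0 < e -> exists2 delta : R, 0 < delta &
        forall x0, interior XN x0 -> `|x0| < delta ->
          forall k, `|xcl x0 k| < e) /\
     (* attractivity: X_N interior is contained in the region of attraction *)
     (forall x0, interior XN x0 -> xcl x0 k @[k --> \oo] --> (0 : 'cV[R]_n))).
Proof.
move=> dx_gt0 du_gt0 X_compact U_compact Q_psd Rw_pd; case: N => // N _ eps_gt0 _.
move=> Bx_log Bu_log _ _ _ _ _ B_le_M P_pd P_lyapunov Xf_convex _ _ Xf_sub _.
move=> Bf_rec Bf_decrease XN J _.
have XNE : interior XN = feasible_states _ _ _ N.+1 :=
  interior_polytopic_feasible_set A B Cx Cu dx_gt0 du_gt0 Bf_rec (ltn0Sn N) Xf_convex.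
rewrite XNE; split=> [x|mu mu_minimizes].
  exact: exists_barrier_cost_minimizer.
have B_le_M_Xf x (Xfx : interior Xf x) := B_le_M x (Xf_sub x (interior_subset Xfx)).
have [invariant stable attractive] := barrier_mpc_asymptotically_stable eps_gt0
  dx_gt0 du_gt0 Bx_log Bu_log Bf_rec Q_psd Rw_pd P_pd X_compact P_lyapunov
  B_le_M_Xf Bf_decrease mu_minimizes.
rewrite cl_stateE; split=> // x0 x0_feasible k.
have xk_feasible := invariant x0 k x0_feasible.
by have [] := barrier_mpc_strict eps_gt0 mu_minimizes xk_feasible.
Qed.
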